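(* Let $F$ be a field of characteristic not $2$ and not $3$, let $\alpha,t\in F$, put $\bar\alpha=1-\alpha$, and let $E$ be a vector space over $F$ endowed with a nondegenerate symmetric bilinear form $\langle\cdot,\cdot\rangle$. On the vector space $V=Fz_1\oplus Fz_2\oplus E$ define, for $a,b,k,l\in F$ and $u,v\in E$, $$N(az_1+bz_2+v)=ab(\alpha a+\bar\alpha b)-\langle v,v\rangle(\bar\alpha t a+\alpha b),$$ $$\Delta(az_1+bz_2+v,\,kz_1+lz_2+u)=\alpha(\alpha-1)(a-b)(k-l)-\langle u,v\rangle(\bar\alpha+\alpha t),$$ $$(az_1+bz_2+v)^\#=(\alpha a+\bar\alpha b)(bz_1+az_2)+(t-1)\langle v,v\rangle(-\bar\alpha z_1+\alpha z_2)-(\bar\alpha a+\alpha b)v,$$ and $c=z_1+z_2$. Then $(N,\Delta,\#,c)$ is a generalized sharped cubic form on $V$, and the product $rs=\frac12\big(r_\#s+T(r)s+T(s)r-S(r,s)c\big)$ induced by it on $V$ coincides with the product of the algebra $S(\alpha,t,E)$, that is, for $r=az_1+bz_2+v$ and $s=kz_1+lz_2+u$, $$rs=akz_1+blz_2+\langle v,u\rangle(z_1+tz_2)+(\alpha k+\bar\alpha l)v+(\alpha a+\bar\alpha b)u .$$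
   Context: Cubic forms. A cubic form on a vector space $V$ over $F$ is a map $N\colon V\to F$ such that $N(x+\lambda y)=N(x)+\lambda N(x,y)+\lambda^2N(y,x)+\lambda^3N(y)$ for all $\lambda\in F$, $x,y\in V$, where $N(x,y)$ is quadratic in $x$ and linear in $y$, and the complete linearization $N(x,y,z)=N(x+y+z)-N(x+y)-N(x+z)-N(y+z)+N(x)+N(y)+N(z)$ is trilinear and symmetric. One has $N(x,y)=N(x,x,y)/2$. Generalized cubic form. Let $N$ be a cubic form on $V$, $c\in V$ with $N(c)=1$ (the basepoint), and $\Delta$ a symmetric bilinear form on $V$ with $\Delta(r,c)=0$ for all $r\in V$. Put $S(r)=N(r,r,c)/2$, $T(r)=N(r,c,c)/2$, $S(r,q)=N(r,q,c)$ and $(r,q)=T(r)T(q)-S(r,q)-\Delta(r,q)$. The pair $(N,\Delta)$ is called a generalized cubic form. Generalized sharped cubic form. A sharp map for $(N,\Delta,c)$ is a quadratic map $\#\colon V\to V$, $r\mapsto r^\#$, with bilinear polarization $r_\#q=(r+q)^\#-r^\#-q^\#$, such that for all $r,q\in V$: $(r_\#q,r)+(r^\#,q)=3N(r,q)$; $(r^\#)^\#=(N(r)+\Delta(r^\#,r))r$; $c_\#r=T(r)c-r$. Then $(N,\Delta,\#,c)$ is called a generalized sharped cubic form on $V$. $S(\alpha,t,E)=Fz_1\oplus Fz_2\oplus E$ is the commutative algebra with $z_1^2=z_1$, $z_2^2=z_2$, $z_1z_2=0$, $ez_1=\alpha e$, $ez_2=(1-\alpha)e$, $ef=\langle e,f\rangle(z_1+tz_2)$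 for $e,f\in E$. *)

(* Defs.v *)
From mathcomp Require Import all_boot all_order all_algebra.
From mathcomp Require Import ring.

Set Implicit Arguments.
Unset Strict Implicit.
Unset Printing Implicit Defensive.

Import GRing.Theory.
Local Open Scope ring_scope.

Definition polar (V W : zmodType) (q : V -> W) (x y : V) : W :=
  q (x + y) - q x - q y.

Definition quadratic_map (F : fieldType) (V W : lmodType F) (q : V -> W) :
    Prop :=
  (forall (a : F) (x : V), q (a *: x) = a ^+ 2 *: q x) /\
  bilinear_for *:%R *:%R (polar q).

Section CubicForm.
Variables (F : fieldType) (V : lmodType F).
Implicit Types (N : V -> F) (Delta : V -> V -> F) (sharp : V -> V) (c : V).

(* N(x, y, z) *)
Definition cubic_lin3 N (x y z : V) : F :=
  N (x + y + z) - N (x + y) - N (x + z) - N (y + z) + N x + N y + N z.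

(* [N2 x y] is the coefficient N(x, y), quadratic in x and linear in y *)
Definition cubic_expansion N (N2 : V -> V -> F) : Prop :=
  [/\ forall y, quadratic_map ((fun x => N2 x y) : V -> F^o),
      forall x, scalar (N2 x)
    & forall (a : F) (x y : V),
        N (x + a *: y) = N x + a * N2 x y + a ^+ 2 * N2 y x + a ^+ 3 * N y].

Record cubic_form N : Prop := CubicForm {
  cubic_form_expansion : exists N2 : V -> V -> F, cubic_expansion N N2;
  cubic_form_scalar1 : forall y z, scalar (fun x => cubic_lin3 N x y z);
  cubic_form_scalar2 : forall x z, scalar (fun y => cubic_lin3 N x y z);
  cubic_form_scalar3 : forall x y, scalar (fun z => cubic_lin3 N x y z);
  cubic_form_sym12 : forall x y z, cubic_lin3 N x y z = cubic_lin3 N y x z;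
  cubic_form_sym23 : forall x y z, cubic_lin3 N x y z = cubic_lin3 N x z y
}.

(* N(x, y); see [cubic_expansion_unique] below *)
Definition cubic_lin2 N (x y : V) : F := cubic_lin3 N x x y / 2%:R.

Lemma cubic_expansion_unique N (N2 : V -> V -> F) : (2 \notin [pchar F])%N ->
  cubic_expansion N N2 -> forall x y, N2 x y = cubic_lin2 N x y.
Proof.
move=> char2 [quadN2 linN2 NE] x y.
have two0 : 2%:R != 0 :> F by rewrite inE /= in char2.
have N20 z : N2 0 z = 0.
  have [hom _] := quadN2 z.
  by have /= := hom 0 0; rewrite scaler0 expr0n /= scale0r.
have N2r z : N2 z 0 = 0.
  have /= := linN2 z (-1) 0 0.
  by rewrite scaler0 addr0 mulN1r addNr.
have N0 : N 0 = 0.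
  have /eqP := NE 1 0 0.
  rewrite scaler0 addr0 N20 !mulr0 !addr0 expr1n mul1r.
  by rewrite -[X in X == _]addr0 (inj_eq (addrI _)) eq_sym => /eqP.
have N2x z : N (z + z) = 8%:R * N z.
  have := NE 2%:R 0 z; rewrite add0r N20 N2r N0 scaler_nat mulr2n => ->.
  by ring.
have NxyE : N (x + y) = N y + N2 y x + N2 x y + N x.
  by have := NE 1 y x; rewrite scale1r addrC => ->; ring.
have NxxyE : N (x + x + y)
    = N y + 2%:R * N2 y x + 4%:R * N2 x y + 8%:R * N x.
  have := NE 2%:R y x; rewrite scaler_nat mulr2n addrC => ->.
  by ring.
by rewrite /cubic_lin2 /cubic_lin3 NxxyE N2x NxyE; field.
Qed.

Definition cubic_trace N c (r : V) : F := cubic_lin3 N r c c / 2%:R.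

Definition cubic_spur N c (r q : V) : F := cubic_lin3 N r q c.

Definition trace_form N Delta c (r q : V) : F :=
  cubic_trace N c r * cubic_trace N c q - cubic_spur N c r q - Delta r q.

Record generalized_cubic_form N Delta c : Prop := GeneralizedCubicForm {
  gcf_cubic : cubic_form N;
  gcf_basepoint : N c = 1;
  gcf_bilinear : bilinear_for *%R *%R Delta;
  gcf_sym : forall r q, Delta r q = Delta q r;
  gcf_radical : forall r, Delta r c = 0
}.

Record generalized_sharped_cubic_form N Delta sharp c : Prop :=
    GeneralizedSharpedCubicForm {
  gscf_cubic : generalized_cubic_form N Delta c;
  gscf_quadratic : quadratic_map sharp;
  gscf_trace : forall r q,
    trace_form N Delta c (polar sharp r q) r + trace_form N Delta c (sharp r) q
      = 3%:R * cubic_lin2 N r q;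
  gscf_adjoint : forall r,
    sharp (sharp r) = (N r + Delta (sharp r) r) *: r;
  gscf_unit : forall r, polar sharp c r = cubic_trace N c r *: c - r
}.

Definition induced_product N sharp c (r s : V) : V :=
  2%:R^-1 *: (polar sharp r s + cubic_trace N c r *: s
              + cubic_trace N c s *: r - cubic_spur N c r s *: c).

End CubicForm.

(* F z1 (+) F z2 (+) E, the triple (a, b, v) being a z1 + b z2 + v *)
Definition Sspace (F : fieldType) (E : lmodType F) : lmodType F :=
  (F^o * F^o * E)%type.

Section SAlgebra.
Variables (F : fieldType) (E : lmodType F).

Definition Sz1 : Sspace E := (1, 0, 0).
Definition Sz2 : Sspace E := (0, 1, 0).
Definition Sin (v : E) : Sspace E := (0, 0, v).

Lemma SspaceE (a b : F) (v : E) :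
  ((a, b, v) : Sspace E) = a *: Sz1 + b *: Sz2 + Sin v.
Proof.
congr (_, _, _); rewrite /= ?scaler0 ?addr0 ?add0r //.
  by rewrite /GRing.scale /= mulr1.
by rewrite /GRing.scale /= mulr1.
Qed.

Variables (form : E -> E -> F) (alpha t : F).

(* bilinearity, commutativity and the multiplication table of S(alpha, t, E);
   together they determine [mul] *)
Record S_product (mul : Sspace E -> Sspace E -> Sspace E) : Prop := SProduct {
  S_mul_bilinear : bilinear_for *:%R *:%R mul;
  S_mulC : forall r s, mul r s = mul s r;
  S_mul_z1z1 : mul Sz1 Sz1 = Sz1;
  S_mul_z2z2 : mul Sz2 Sz2 = Sz2;
  S_mul_z1z2 : mul Sz1 Sz2 = 0;
  S_mul_Ez1 : forall e, mul (Sin e) Sz1 = alpha *: Sin e;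
  S_mul_Ez2 : forall e, mul (Sin e) Sz2 = (1 - alpha) *: Sin e;
  S_mul_EE : forall e f, mul (Sin e) (Sin f) = form e f *: (Sz1 + t *: Sz2)
}.

Definition Snorm (r : Sspace E) : F :=
  let: (a, b, v) := r in
  a * b * (alpha * a + (1 - alpha) * b)
  - form v v * ((1 - alpha) * t * a + alpha * b).

Definition Sdelta (r s : Sspace E) : F :=
  let: (a, b, v) := r in let: (k, l, u) := s in
  alpha * (alpha - 1) * (a - b) * (k - l)
  - form u v * ((1 - alpha) + alpha * t).

Definition Ssharp (r : Sspace E) : Sspace E :=
  let: (a, b, v) := r in
  (alpha * a + (1 - alpha) * b) *: (b *: Sz1 + a *: Sz2)
  + ((t - 1) * form v v) *: (- (1 - alpha) *: Sz1 + alpha *: Sz2)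
  - ((1 - alpha) * a + alpha * b) *: Sin v.

Definition Sbase : Sspace E := Sz1 + Sz2.

End SAlgebra.

Arguments Sz1 {F} E.
Arguments Sz2 {F} E.
Arguments Sbase {F} E.

(* Main.v *)
Require Import Defs.
From mathcomp Require Import all_boot all_order all_algebra.
From mathcomp Require Import ring.
Import GRing.Theory.
Local Open Scope ring_scope.

(* Since 2 is invertible, the complete linearization N(x, y, z) determines
   N(x, y), T, S and the trace form, and explicit coordinates turn every axiom
   into a polynomial identity. *)

(** Write r = (a, b, v). [N], [Delta] and both F-coordinates of r^# involve v only through values of
    the form, and the E-component of r^# is a scalar multiple of v. Each axiom thus splits into
    polynomial identities in the F-coordinates, the form values, alpha and t, together with a
    comparison of coefficients of v and u in E. The weight is carried by three closed formulas:
    [Snorm_lin3] for the complete linearization, [Strace_formE] for the trace form, which turns out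
    to be diagonal, and [Spolar_sharpE] for the polarized sharp. Halving the combination of traces,
    spur and polarized sharp gives [Sinduced_productE], whose values on z1, z2 and E are the
    multiplication table. *)

Lemma polarC (V W : zmodType) (q : V -> W) (x y : V) :
  polar q x y = polar q y x.
Proof. by rewrite /polar [y + x]addrC addrAC. Qed.

(** Symmetry is formal for an arbitrary map, so trilinearity of the linearization needs to be
    computed in one slot only. *)
Lemma cubic_lin3_sym12 (F : fieldType) (V : lmodType F) (N : V -> F)
    (x y z : V) : cubic_lin3 N x y z = cubic_lin3 N y x z.
Proof. by rewrite /cubic_lin3 [y + x]addrC; ring. Qed.

Lemma cubic_lin3_sym23 (F : fieldType) (V : lmodType F) (N : V -> F)
    (x y z : V) : cubic_lin3 N x y z = cubic_lin3 N x z y.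
Proof. by rewrite /cubic_lin3 [z + y]addrC [x + z + y]addrAC; ring. Qed.

(** Handles E-components where a vector and a scalar coefficient both depend linearly on the varied
    argument. Read from right to left, it reduces linearity to equality of the coefficients. *)
Lemma scaler_lin2 (R : comPzRingType) (V : lmodType R) (x p q1 q2 : R)
    (v v' u : V) :
  p *: (x *: v + v') + (x * q1 + q2) *: u
  = x *: (p *: v + q1 *: u) + (p *: v' + q2 *: u).
Proof.
by rewrite !scalerDr scalerDl !scalerA addrACA [p * x]mulrC.
Qed.

Section SharpedForm.
Variables (F : fieldType) (alpha t : F) (E : lmodType F) (form : {biscalar E}).
Hypothesis two_neq0 : 2%:R != 0 :> F.
Hypothesis form_sym : forall u v : E, form u v = form v u.

Local Notation N := (Snorm form alpha t).
Local Notation Delta := (Sdelta form alpha t).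
Local Notation sharp := (Ssharp form alpha t).
Local Notation c := (Sbase E).
Local Notation triple a b v := ((a, b, v) : Sspace E).

Lemma SspaceD (a b k l : F) (v u : E) :
  triple a b v + triple k l u = triple (a + k) (b + l) (v + u).
Proof. by []. Qed.

(** Holds by conversion, because scaling in [F^o] is multiplication; later unfoldings of
    [GRing.scale] expose the same fact to [ring] and [field]. *)
Lemma SspaceZ (x a b : F) (v : E) :
  x *: triple a b v = triple (x * a) (x * b) (x *: v).
Proof. by []. Qed.

Lemma SspaceN (a b : F) (v : E) : - triple a b v = triple (- a) (- b) (- v).
Proof. by []. Qed.

Definition SspaceP := (SspaceZ, SspaceN, SspaceD).

Lemma SbaseE : c = triple 1 1 0.
Proof. by rewrite /Sbase /Sz1 /Sz2 SspaceD addr0 add0r addr0. Qed.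

Lemma SsharpE (a b : F) (v : E) :
  sharp (a, b, v) =
  triple ((alpha * a + (1 - alpha) * b) * b
            - (t - 1) * form v v * (1 - alpha))
         ((alpha * a + (1 - alpha) * b) * a + (t - 1) * form v v * alpha)
         (- ((1 - alpha) * a + alpha * b) *: v).
Proof.
rewrite /Ssharp /Sz1 /Sz2 /Sin !SspaceP.
congr (_, _, _) => /=; [ring | ring |].
by rewrite !(scaler0, add0r) scaleNr.
Qed.

Definition formE := (linearDl, linearDr, linearZl_LR, linearZr_LR,
  linearNl, linearNr, linear0l, linear0r).

(** Every monomial of [N] has a repeated factor (a, b or v), so polarizing produces the overall 2
    that the halves in N(x, y) and T cancel. *)
Lemma Snorm_lin3 (a b k l m n : F) (v u w : E) :
  cubic_lin3 N (a, b, v) (k, l, u) (m, n, w) =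
  2%:R * (alpha * (a * k * n + a * l * m + b * k * m)
    + (1 - alpha) * (a * l * n + b * k * n + b * l * m)
    - ((1 - alpha) * t * a + alpha * b) * form u w
    - ((1 - alpha) * t * k + alpha * l) * form v w
    - ((1 - alpha) * t * m + alpha * n) * form v u).
Proof.
rewrite /cubic_lin3 !SspaceD /Snorm.
rewrite !formE /=.
rewrite (form_sym u v) (form_sym w v) (form_sym w u).
ring.
Qed.

Lemma Snorm_lin2 (a b k l : F) (v u : E) :
  cubic_lin2 N (a, b, v) (k, l, u) =
  alpha * (a * a * l + 2%:R * a * b * k)
    + (1 - alpha) * (2%:R * a * b * l + b * b * k)
    - 2%:R * ((1 - alpha) * t * a + alpha * b) * form v u
    - ((1 - alpha) * t * k + alpha * l) * form v v.
Proof. by rewrite /cubic_lin2 Snorm_lin3; field. Qed.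

Lemma Snorm_trace (a b : F) (v : E) :
  cubic_trace N c (a, b, v) = (1 + alpha) * a + (1 + (1 - alpha)) * b.
Proof. by rewrite /cubic_trace SbaseE Snorm_lin3 !formE; field. Qed.

Lemma Snorm_spur (a b k l : F) (v u : E) :
  cubic_spur N c (a, b, v) (k, l, u) =
  2%:R * (alpha * (a * k + a * l + b * k)
    + (1 - alpha) * (a * l + b * k + b * l)
    - ((1 - alpha) * t + alpha) * form v u).
Proof. by rewrite /cubic_spur SbaseE Snorm_lin3 !formE; ring. Qed.

(** [Delta] is what makes the form diagonal: the coefficient of a l and of b k is (1 + alpha)(2 -
    alpha) - 2 + alpha (alpha - 1) = 0. *)
Lemma Strace_formE (a b k l : F) (v u : E) :
  trace_form N Delta c (a, b, v) (k, l, u) =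
  (1 + alpha) * (a * k) + (2%:R - alpha) * (b * l)
    + ((1 + alpha) + (2%:R - alpha) * t) * form v u.
Proof.
rewrite /trace_form !Snorm_trace Snorm_spur /Sdelta (form_sym u v).
ring.
Qed.

Lemma Spolar_sharpE (a b k l : F) (v u : E) :
  polar sharp (a, b, v) (k, l, u) =
  triple (alpha * (a * l + b * k) + 2%:R * (1 - alpha) * (b * l)
            - 2%:R * (t - 1) * (1 - alpha) * form v u)
         (2%:R * alpha * (a * k) + (1 - alpha) * (a * l + b * k)
            + 2%:R * (t - 1) * alpha * form v u)
         (- ((1 - alpha) * k + alpha * l) *: v
          - ((1 - alpha) * a + alpha * b) *: u).
Proof.
rewrite /polar SspaceD !SsharpE.
congr (_, _, _) => /=; rewrite ?formE /= ?(form_sym u v); [ring | ring |].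
(* With m(r) = (1 - alpha) a + alpha b linear, the diagonal terms m(r) v and m(s) u cancel; the
   rearrangement collects the multiples of v and of u. *)
rewrite -!scaleNr !scalerDr.
rewrite -addrA addrACA [_ *: u + _]addrC.
rewrite -!scalerDl.
by congr (_ *: _ + _ *: _); ring.
Qed.

(** The mixed terms a l and b k cancel in both F-coordinates, whence z1 z2 = 0. The (t - 1) terms of
    the sharp correct the spur contribution 2 ((1 - alpha) t + alpha) to 2 on z1 and to 2 t on
    z2. *)
Lemma Sinduced_productE (a b k l : F) (v u : E) :
  induced_product N sharp c (a, b, v) (k, l, u) =
  triple (a * k + form v u) (b * l + t * form v u)
         ((alpha * k + (1 - alpha) * l) *: v
          + (alpha * a + (1 - alpha) * b) *: u).
Proof.
rewrite /induced_product Spolar_sharpE !Snorm_trace Snorm_spur SbaseE.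
congr (_, _, _) => /=.
- by rewrite /GRing.scale /=; field.
- by rewrite /GRing.scale /=; field.
(* The basepoint has no E-component, so the spur term vanishes here. *)
rewrite scaler0 subr0 -scaleNr -addrA [X in _ + X]addrC addrACA -!scalerDl.
rewrite scalerDr !scalerA.
by congr (_ *: _ + _ *: _); field.
Qed.

Lemma Snorm_cubic_expansion : cubic_expansion N (cubic_lin2 N).
Proof.
split.
- move=> [[m n] w]; split=> [x [[a b] v]|].
    by rewrite SspaceZ !Snorm_lin2 !formE /GRing.scale /=; ring.
  split=> -[[k l] u] x [[a b] v] [[a' b'] v'];
    rewrite /polar /= !SspaceZ !SspaceD !Snorm_lin2 !formE /GRing.scale /=.
  + by ring.
  + by ring.
- move=> [[a b] v] x [[k l] u] [[m n] w].
  by rewrite SspaceZ SspaceD !Snorm_lin2 !formE /=; ring.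
- move=> x [[a b] v] [[k l] u].
  rewrite SspaceZ SspaceD !Snorm_lin2 /Snorm !formE /=.
  by rewrite (form_sym u v); ring.
Qed.

Lemma Snorm_cubic_form : cubic_form N.
Proof.
have lin1 y z : scalar (fun x => cubic_lin3 N x y z).
  case: y z => [[k l] u] [[m n] w] x [[a b] v] [[a' b'] v'].
  by rewrite SspaceZ SspaceD !Snorm_lin3 !formE /=; ring.
split.
- by exists (cubic_lin2 N); exact: Snorm_cubic_expansion.
- by [].
- by move=> x z a y y'; rewrite ![cubic_lin3 N x _ z]cubic_lin3_sym12 lin1.
- move=> x y a z z'.
  rewrite ![cubic_lin3 N x y _]cubic_lin3_sym23.
  by rewrite ![cubic_lin3 N x _ y]cubic_lin3_sym12 lin1.
- exact: cubic_lin3_sym12.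
- exact: cubic_lin3_sym23.
Qed.

Lemma Sdelta_sym (r s : Sspace E) : Delta r s = Delta s r.
Proof.
case: r s => [[a b] v] [[k l] u].
by rewrite /Sdelta (form_sym u v); ring.
Qed.

Lemma Sdelta_bilinear : bilinear_for *%R *%R Delta.
Proof.
have lin s : scalar (Delta^~ s).
  case: s => [[k l] u] x [[a b] v] [[a' b'] v'].
  by rewrite SspaceZ SspaceD /Sdelta !formE /=; ring.
by split=> // r x s s'; rewrite ![Delta r _]Sdelta_sym lin.
Qed.

Lemma Sgeneralized_cubic_form : generalized_cubic_form N Delta c.
Proof.
split.
- exact: Snorm_cubic_form.
- by rewrite SbaseE /Snorm !formE; ring.
- exact: Sdelta_bilinear.
- exact: Sdelta_sym.
- by case=> [[a b] v]; rewrite SbaseE /Sdelta !formE; ring.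
Qed.

Lemma Ssharp_quadratic : quadratic_map sharp.
Proof.
split=> [x [[a b] v]|].
  rewrite SspaceZ !SsharpE; congr (_, _, _) => /=; rewrite ?formE ?scalerA.
  - by rewrite /GRing.scale /=; ring.
  - by rewrite /GRing.scale /=; ring.
  by congr (_ *: _); ring.
have lin s : linear (polar sharp ^~ s).
  case: s => [[k l] u] x [[a b] v] [[a' b'] v'].
  rewrite SspaceZ SspaceD !Spolar_sharpE !formE /=.
  congr (_, _, _) => /=; rewrite -?scaleNr -?scaler_lin2.
  - by rewrite /GRing.scale /=; ring.
  - by rewrite /GRing.scale /=; ring.
  by congr (_ *: _ + _ *: _); ring.
by split=> // r x s s'; rewrite ![polar sharp r _]polarC lin.
Qed.

Lemma Sgeneralized_sharped_cubic_form :
  generalized_sharped_cubic_form N Delta sharp c.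
Proof.
split.
- exact: Sgeneralized_cubic_form.
- exact: Ssharp_quadratic.
- case=> [[a b] v] [[k l] u].
  rewrite Spolar_sharpE SsharpE !Strace_formE Snorm_lin2 !formE.
  by rewrite (form_sym u v); ring.
- case=> [[a b] v].
  (* The E-component of r^# is a multiple of v, so only [form v v] occurs, and in E both sides are
     multiples of v. *)
  rewrite [sharp (a, b, v)]SsharpE SsharpE /Snorm /Sdelta SspaceZ !formE.
  congr (_, _, _) => /=; rewrite ?scalerA.
  - by rewrite /GRing.scale /=; ring.
  - by rewrite /GRing.scale /=; ring.
  by congr (_ *: _); ring.
- case=> [[a b] v].
  rewrite Snorm_trace SbaseE Spolar_sharpE SspaceZ SspaceN SspaceD !formE.
  congr (_, _, _) => /=; [ring | ring |].
  (* At the basepoint the coefficient (1 - alpha) + alpha of v collapses to 1. *)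
  rewrite !scaler0 !add0r -!scaleNr -scaleN1r; congr (_ *: _); ring.
Qed.

Lemma Sinduced_product_S_product :
  S_product form alpha t (induced_product N sharp c).
Proof.
have mulC r s : induced_product N sharp c r s = induced_product N sharp c s r.
  case: r s => [[a b] v] [[k l] u]; rewrite !Sinduced_productE (form_sym u v).
  by congr (_, _, _); [rewrite mulrC | rewrite [b * l]mulrC | rewrite addrC].
have lin s : linear (induced_product N sharp c ^~ s).
  case: s => [[k l] u] x [[a b] v] [[a' b'] v'].
  rewrite SspaceZ SspaceD !Sinduced_productE !formE.
  congr (_, _, _) => /=; rewrite -?scaler_lin2.
  - by rewrite /GRing.scale /=; ring.
  - by rewrite /GRing.scale /=; ring.
  by congr (_ *: _ + _ *: _); ring.
split=> //; rewrite /Sz1 /Sz2 /Sin.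
- by split=> // r x s s'; rewrite ![induced_product N sharp c r _]mulC lin.
- rewrite Sinduced_productE !formE; congr (_, _, _) => /=; [ring | ring |].
  by rewrite !scaler0 addr0.
- rewrite Sinduced_productE !formE; congr (_, _, _) => /=; [ring | ring |].
  by rewrite !scaler0 addr0.
- rewrite Sinduced_productE !formE; congr (_, _, _) => /=; [ring | ring |].
  by rewrite !scaler0 addr0.
- move=> e; rewrite Sinduced_productE SspaceZ !formE.
  congr (_, _, _) => /=; [ring | ring |].
  by rewrite !scaler0 addr0; congr (_ *: _); ring.
- move=> e; rewrite Sinduced_productE SspaceZ !formE.
  congr (_, _, _) => /=; [ring | ring |].
  by rewrite !scaler0 addr0; congr (_ *: _); ring.
- move=> e f; rewrite Sinduced_productE !SspaceP.
  congr (_, _, _) => /=; [ring | ring |].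
  by rewrite !mulr0 !addr0 !scale0r !scaler0 addr0 scaler0.
Qed.

End SharpedForm.

Theorem mainTheorem2 (F : fieldType)
    (char_not2 : (2 \notin [pchar F])%N) (char_not3 : (3 \notin [pchar F])%N)
    (alpha t : F) (E : lmodType F) (form : {biscalar E})
    (form_sym : forall u v : E, form u v = form v u)
    (form_nondeg : forall u : E, (forall v : E, form u v = 0) -> u = 0) :
  [/\ generalized_sharped_cubic_form (Snorm form alpha t)
        (Sdelta form alpha t) (Ssharp form alpha t) (Sbase E),
      S_product form alpha t
        (induced_product (Snorm form alpha t) (Ssharp form alpha t) (Sbase E))
    & forall (a b k l : F) (v u : E),
        induced_product (Snorm form alpha t) (Ssharp form alpha t) (Sbase E)
          (a *: Sz1 E + b *: Sz2 E + Sin v) (k *: Sz1 E + l *: Sz2 E + Sin u)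
        = (a * k) *: Sz1 E + (b * l) *: Sz2 E
          + form v u *: (Sz1 E + t *: Sz2 E)
          + (alpha * k + (1 - alpha) * l) *: Sin v
          + (alpha * a + (1 - alpha) * b) *: Sin u].
Proof.
(* As 2 is prime, it fails to be the characteristic only if it is nonzero in F; this allows the
   divisions by 2. *)
have two_neq0 : 2%:R != 0 :> F by rewrite inE /= in char_not2.
split.
- exact: Sgeneralized_sharped_cubic_form.
- exact: Sinduced_product_S_product.
move=> a b k l v u.
rewrite -!SspaceE Sinduced_productE // /Sz1 /Sz2 /Sin !SspaceP.
congr (_, _, _) => /=.
- by rewrite /GRing.scale /=; ring.
- by rewrite /GRing.scale /=; ring.
by rewrite !(scaler0, addr0, add0r).
Qed.
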